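(* Let $K$ be a discretely valued Henselian field with value group $\mathbb{Z}$ and residue characteristic $p$, let $q\neq p$ be a prime, and let $C/K$ be the superelliptic curve of degree $q$ given by $y^q=F(x)$, with $F(x)\in K[x]$. Suppose that the residue field of $K$ is algebraically closed and that every root of $F(x)$ is tamely ramified. Fix a Galois-invariant cluster $\mathfrak{s}$ of roots of $F(x)$, and let $\gamma_{\mathfrak{s}}\in K$ be the element constructed from $\mathfrak{s}$. Let $r$ be a natural number not divisible by $q$. If there exists $P\in U(\overline{K})$ of degree $r$ with $x(P)\in X_{\mathfrak{s}}$, then one of the following holds: (i) $|\mathfrak{s}|\not\equiv 0\pmod q$, or (ii) $|\mathfrak{s}|\equiv 0\pmod q$ and $c_{\mathfrak{s}}\equiv 0\pmod q$, or (iii) $0\in X_{\mathfrak{s}}$ and $v(F(0))\equiv 0\pmod q$, or (iv) $\gamma_{\mathfrak{s}}\in X_{\mathfrak{s}}$ and $v(F(\gamma_{\mathfrak{s}}))\equiv 0\pmod q$.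
   Context: $v$ is the valuation on $\overline{K}$ extending that of $K$, normalized so that $v(K^\times)=\mathbb{Z}$ (with $v(0)=+\infty$, which is not regarded as congruent to $0$ mod $q$); $|\cdot|$ is an associated absolute value and $\pi$ is a uniformizer of $K$. A curve is a smooth, projective, geometrically integral scheme of dimension 1 over a field. A superelliptic curve $C/K$ of degree $q$ is the normalization of the projective closure of the affine curve $y^q=F(x)$, where $F(x)\in K[x]$ is nonconstant and not divisible by the $q$-th power of a nonconstant polynomial. Write $F(x)=a_d\prod_i(x-\alpha_i)$ over $\overline{K}$. The roots $\{\alpha_i\}$ are listed with multiplicity; cardinalities of sets of roots and sums over sets of roots are taken with multiplicity. A root $\alpha$ is tamely ramified if $K(\alpha)/K$ is a tamely ramified extension. $U\subseteq C$ is the affine open subset isomorphic to the affine curve $\{y^q=F(x)\}$ with the points $(\alpha_i,0)$ removed; $x$ is the $x$-coordinate map; a point $P=(x_0,y_0)\in U(\overline{K})$ has degree $[K(x_0,y_0):K]$ and $x(P)=x_0$. A cluster is a nonempty subset $\mathfrak{s}\subseteq\{\alpha_i\}$ of the form $\mathfrak{s}=D\cap\{\alpha_i\}$ with $D=\{x\in\overline{K}:|x-z|\le d\}$ for some $z\in\overline{K}$, $d\in\mathbb{R}$; $\mathfrak{s}^c$ is its complement in $\{\alpha_i\}$. It is Galois invariant if it is stable (as a set) under $\mathrm{Gal}(K^{\mathrm{sep}}/K)$. For $x\in\overline{K}$ put $R_x=\min_i|x-\alpha_i|$, and let $X_{\mathfrak{s}}=\{x\in\overline{K}:|x-\alpha|=R_x\text{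 for all }\alpha\in\mathfrak{s},\ |x-\alpha'|>R_x\text{ for all }\alpha'\notin\mathfrak{s}\}$, where $\alpha'$ ranges over roots of $F$. $c_{\mathfrak{s}}=v(a_d)+\sum_{\beta\in\mathfrak{s}^c}v(\alpha-\beta)$ for any $\alpha\in\mathfrak{s}$ (independent of $\alpha$; an integer when $\mathfrak{s}$ is Galois invariant under the present hypotheses). Construction of $\gamma_{\mathfrak{s}}\in K$: if $\mathfrak{s}$ consists of a single root $\alpha$, put $\gamma_{\mathfrak{s}}=\alpha$. Otherwise let $L$ be the splitting field of $F$ over $K$; by tameness, $L=K(\tau)$ with $\tau^m=\pi$ for some $m$, $\tau$ a uniformizer of $L$. Expand elements of $L$ as series $\sum_i b_i\tau^i$ with $b_i$ in a fixed set of representatives in $K$ (containing $0$) of the residue field. Choose $\alpha,\alpha'\in\mathfrak{s}$ with $|\alpha-\alpha'|$ maximal, write $\alpha=\sum_i b_i\tau^i$, $\alpha'=\sum_i b_i'\tau^i$, let $N'$ be the smallest integer with $b_{N'}\neq b'_{N'}$, and set $\gamma_{\mathfrak{s}}=\sum_{i<N'}b_i\tau^i$. This lies in $K$. *)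

(* Defs.v *)
From mathcomp Require Import all_boot all_order all_algebra separable.
From mathcomp Require Import constructive_ereal reals exp.

Set Implicit Arguments.
Unset Strict Implicit.
Unset Printing Implicit Defensive.

Import Order.TTheory GRing.Theory Num.Theory.
Local Open Scope ring_scope.

Record valuation (R : realType) (k : fieldType) (v : k -> \bar R) : Prop := {
  valuation0 : v 0 = +oo%E ;
  valuation_fin : forall x, x != 0 -> v x \is a fin_num ;
  valuationM : forall x y, v (x * y) = (v x + v y)%E ;
  valuationD : forall x y, (Order.min (v x) (v y) <= v (x + y)%R)%E }.

Definition value_group_Z (R : realType) (K : fieldType) (vK : K -> \bar R) :=
  (forall a, a != 0 -> exists n : int, vK a = (n%:~R)%:E) /\
  (forall n : int, exists2 a, a != 0 & vK a = (n%:~R)%:E).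

Definition henselian (R : realType) (K : fieldType) (vK : K -> \bar R) :=
  forall (f : {poly K}) (a : K),
    f \is monic -> (forall i, (0 <= vK f`_i)%E) -> (0 <= vK a)%E ->
    (0 < vK f.[a])%E -> vK f^`().[a] = 0%E ->
    exists b : K, root f b /\ (0 < vK (b - a)%R)%E.

(* red is reduction modulo the maximal ideal, identifying k with the residue
   field of vK; its values outside the valuation ring are irrelevant. *)
Record residue_map (R : realType) (K : fieldType) (vK : K -> \bar R)
    (k : fieldType) (red : K -> k) : Prop := {
  residue1 : red 1 = 1 ;
  residueD : forall x y, (0 <= vK x)%E -> (0 <= vK y)%E ->
    red (x + y) = red x + red y ;
  residueM : forall x y, (0 <= vK x)%E -> (0 <= vK y)%E ->
    red (x * y) = red x * red y ;
  residue_surj : forall a, exists2 x, (0 <= vK x)%E & red x = a ;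
  residue_eq0 : forall x, (0 <= vK x)%E -> (red x = 0 <-> (0 < vK x)%E) }.

Definition residue_representatives (R : realType) (K : fieldType)
    (vK : K -> \bar R) (k : fieldType) (red : K -> k) (rep : k -> K) :=
  rep 0 = 0 /\ forall a, (0 <= vK (rep a))%E /\ red (rep a) = a.

Definition has_characteristic (k : fieldType) (p : nat) :=
  if p == 0%N then [pchar k] =i pred0 else p \in [pchar k].

Definition algebraic_closure (K : fieldType) (Kbar : closedFieldType)
    (iota : {rmorphism K -> Kbar}) :=
  forall x, algebraicOver iota x.

Section FieldExtensions.
Variables (K : fieldType) (E : fieldType) (iota : {rmorphism K -> E}).

(* Membership in K(S): x lies in every subfield of E containing K and S. *)
Definition adjoin (S : seq E) (x : E) : Prop :=
  forall M : {pred E}, GRing.divring_closed M ->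
    (forall a, iota a \in M) -> {subset S <= M} -> x \in M.

Definition extension_degree (M : E -> Prop) (n : nat) : Prop :=
  exists e : 'I_n -> E,
    [/\ forall i, M (e i),
        forall c : 'I_n -> K,
          \sum_i iota (c i) * e i = 0 -> forall i, c i = 0
      & forall x, M x -> exists c : 'I_n -> K, x = \sum_i iota (c i) * e i].

Definition separable_over (x : E) : Prop :=
  exists2 g : {poly K}, separable_poly g & root (map_poly iota g) x.

(* sigma restricts to an element of Gal(K^sep / K), where K^sep is the set of
   elements of E separable over K; its values outside K^sep are irrelevant. *)
Record galois_automorphism (sigma : E -> E) : Prop := {
  galois_id : forall a, sigma (iota a) = iota a ;
  galoisD : forall x y, separable_over x -> separable_over y ->
    sigma (x + y) = sigma x + sigma y ;
  galoisM : forall x y, separable_over x -> separable_over y ->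
    sigma (x * y) = sigma x * sigma y ;
  galois_sep : forall x, separable_over x -> separable_over (sigma x) ;
  galois_surj : forall y, separable_over y ->
    exists2 x, separable_over x & sigma x = y }.

End FieldExtensions.

Section Ramification.
Variables (R : realType) (K E k : fieldType) (iota : {rmorphism K -> E}).
Variables (vK : K -> \bar R) (red : K -> k) (v : E -> \bar R).

(* As vK has value group Z, index e means that M has value group (1/e)Z. *)
Definition ramification_index (M : E -> Prop) (e : nat) : Prop :=
  (0 < e)%N /\
  forall t : \bar R, (exists x, [/\ M x, x != 0 & v x = t]) <->
                     (exists n : int, t = (n%:~R / e%:R)%:E).

(* The residue class of x is a root of a separable polynomial over k; the
   polynomial is given by a lift g to the valuation ring. *)
Definition separable_residue_extension (M : E -> Prop) : Prop :=
  forall x, M x -> (0 <= v x)%E ->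
    exists g : {poly K},
      [/\ forall i, (0 <= vK g`_i)%E, separable_poly (map_poly red g)
        & (0 < v (map_poly iota g).[x])%E].

(* When p = 0 the divisibility condition on e is vacuous, as e > 0. *)
Definition tamely_ramified (p : nat) (x : E) : Prop :=
  [/\ separable_over iota x,
      separable_residue_extension (adjoin iota [:: x])
    & exists2 e, ramification_index (adjoin iota [:: x]) e & ~~ (p %| e)%N].

Definition uniformizer_of (M : E -> Prop) (tau : E) : Prop :=
  [/\ M tau, (0 < v tau)%E & forall x, M x -> (0 < v x)%E -> (v tau <= v x)%E].

End Ramification.

(* |x| = c ^ (- v x), for a real c > 1. *)
Definition absv (R : realType) (c : R) (E : fieldType) (v : E -> \bar R)
    (x : E) : R :=
  if v x is t%:E then powR c (- t) else 0.

Section Clusters.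
Variables (R : realType) (c : R) (E : fieldType) (v : E -> \bar R).

(* rs lists the roots of F with multiplicity. A cluster is the sublist of the
   roots in a disc, so its size counts roots with multiplicity and its
   complement is [seq b <- rs | b \notin s]. *)
Definition cluster (rs s : seq E) : Prop :=
  s != [::] /\
  exists (z : E) (d : R), s = [seq a <- rs | absv c v (a - z) <= d].

(* The seed of the minimum is itself one of the values when rs is nonempty. *)
Definition root_distance (rs : seq E) (x : E) : R :=
  \big[Num.min/absv c v (x - head 0 rs)]_(a <- rs) absv c v (x - a).

Definition cluster_region (rs s : seq E) (x : E) : Prop :=
  (forall a, a \in s -> absv c v (x - a) = root_distance rs x) /\
  (forall a, a \in rs -> a \notin s ->
     root_distance rs x < absv c v (x - a)).

(* c_s, computed at the root head 0 s of s (the choice is irrelevant when s is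
   a cluster); ad is the leading coefficient. *)
Definition cluster_const (ad : E) (rs s : seq E) : \bar R :=
  (v ad + \sum_(b <- rs | b \notin s) v (head 0 s - b)%R)%E.

End Clusters.

Definition galois_invariant (K E : fieldType) (iota : {rmorphism K -> E})
    (s : seq E) : Prop :=
  forall sigma, galois_automorphism iota sigma ->
    forall a, a \in s -> sigma a \in s.

(* False for t = +oo and for non-integral t. *)
Definition eq0_mod (R : realType) (q : nat) (t : \bar R) : Prop :=
  exists n : int, t = ((q%:Z * n)%:~R)%:E.

Section Gamma.
Variables (R : realType) (c : R) (K E k : fieldType).
Variables (iota : {rmorphism K -> E}) (v : E -> \bar R).
Variables (pi : K) (rep : k -> K).

(* The sum of b_i tau^i over n0 <= i < n0 + n. *)
Definition laurent_sum (tau : E) (b : int -> K) (n0 : int) (n : nat) : E :=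
  \sum_(j < n) iota (b (n0 + j%:Z)) * tau ^ (n0 + j%:Z).

(* x is the sum of the series of the b_i tau^i, with b_i = 0 for i < n0. *)
Definition laurent_expansion (tau : E) (b : int -> K) (n0 : int) (x : E) :=
  [/\ forall i, exists a, b i = rep a,
      forall i, (i < n0)%R -> b i = 0
    & forall B : R, exists N : nat, forall n, (N <= n)%N ->
        (B%:E < v (x - laurent_sum tau b n0 n)%R)%E].

(* Any outcome of the construction, over all choices it leaves open. A multiple
   root taken alone counts as a single root. In the second case N' = n0 + n. *)
Inductive gamma_construction (rs s : seq E) : E -> Prop :=
| Gamma_single a :
    a \in s -> {in s, forall b, b = a} -> gamma_construction rs s a
| Gamma_series tau m a a' b b' (n0 : int) (n : nat) :
    ~ (exists2 a0, a0 \in s & {in s, forall b0, b0 = a0}) ->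
    (forall x, adjoin iota rs x <-> adjoin iota [:: tau] x) ->
    tau ^+ m = iota pi ->
    uniformizer_of v (adjoin iota rs) tau ->
    a \in s -> a' \in s ->
    {in s &, forall d d', absv c v (d - d') <= absv c v (a - a')} ->
    laurent_expansion tau b n0 a ->
    laurent_expansion tau b' n0 a' ->
    b (n0 + n%:Z) <> b' (n0 + n%:Z) ->
    (forall i, (i < n0 + n%:Z)%R -> b i = b' i) ->
    gamma_construction rs s (laurent_sum tau b n0 n).

End Gamma.

Definition superelliptic (K : fieldType) (q : nat) (F : {poly K}) : Prop :=
  (1 < size F)%N /\ forall G : {poly K}, (1 < size G)%N -> ~~ (G ^+ q %| F).

(* The points of U over E, with P = (x(P), y(P)). *)
Definition on_U (K E : fieldType) (iota : {rmorphism K -> E}) (q : nat)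
    (F : {poly K}) (rs : seq E) (P : E * E) : Prop :=
  P.2 ^+ q = (map_poly iota F).[P.1] /\ ~ (P.1 \in rs /\ P.2 = 0).

(* Main.v *)
Require Import Defs.
From mathcomp Require Import all_boot all_order all_algebra all_fingroup separable.
From mathcomp Require Import qpoly mpoly.
From mathcomp Require Import constructive_ereal reals exp.
From mathcomp Require Import ring lra.

(* Let t = v(x(P) - a) for a in s, so that v(F(x(P))) = c_s + |s| t. Since K is
   Henselian, r v(z) is an integer for every nonzero z in K(P); for z = y(P)
   this gives c_s + |s| t in (q/r) Z. The integer c_s is the valuation of the
   coefficient of X^|s| in F(X + gamma), a vertex of the Newton polygon.
   By construction v(gamma - a) >= t for all a in s. If v(x(P) - gamma) = t, then
   r t is an integer, and q | |s| forces q | c_s. Otherwise v(x(P) - gamma) > t,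
   so gamma is as far from each root as x(P) is: it lies in X_s and v(F(gamma)) =
   v(F(x(P))) is an integer in (q/r) Z, hence in q Z.

   The integrality of r v(z) comes from the root form of Hensel's lemma: if a
   polynomial over K has roots of different valuations, then the product of the
   roots of minimal valuation is a dominant root of a polynomial over K (built
   from symmetric functions), hence lies in K. *)

Set Implicit Arguments.
Unset Strict Implicit.
Unset Printing Implicit Defensive.

Import Order.TTheory GRing.Theory Num.Theory.
Local Open Scope ring_scope.

(** * Elementary calculus of a valuation with values in the extended reals *)

Section Valuation.
Variables (R : realType) (E : fieldType) (v : E -> \bar R).
Hypothesis hv : valuation v.

Lemma valuation_EFin x : x != 0 -> exists a : R, v x = a%:E.
Proof. by move=> /(valuation_fin hv) /fineK <-; eexists. Qed.

Lemma valuation_neqNy x : v x != -oo%E.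
Proof.
have [->|/valuation_EFin [a ->//]] := eqVneq x 0.
by rewrite (valuation0 hv).
Qed.

Lemma valuation_neq0 x (a : R) : v x = a%:E -> x != 0.
Proof. by apply: contra_eq_neq => ->; rewrite (valuation0 hv). Qed.

Lemma valuation_lt_neq0 x (t : \bar R) : (v x < t)%E -> x != 0.
Proof.
by move=> xt; apply/eqP => x0; move: xt; rewrite x0 (valuation0 hv) ltNge leey.
Qed.

Lemma valuation1 : v 1 = 0%E.
Proof.
have [a va] := valuation_EFin (oner_neq0 E).
have := valuationM hv 1 1; rewrite mulr1 va -EFinD => -[aE].
by congr EFin; lra.
Qed.

Lemma valuationN x : v (- x) = v x.
Proof.
have N1 : (-1 : E) != 0 by rewrite oppr_eq0 oner_eq0.
have [a va] := valuation_EFin N1.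
have := valuationM hv (-1) (-1); rewrite mulrNN mulr1 valuation1 va -EFinD => -[aE].
have -> : - x = -1 * x by rewrite mulN1r.
rewrite (valuationM hv) va (_ : a = 0) ?add0e//; lra.
Qed.

Lemma valuationD_ge (t : \bar R) x y : (t <= v x -> t <= v y -> t <= v (x + y)%R)%E.
Proof.
by move=> tx ty; apply: le_trans (valuationD hv x y); rewrite le_min tx ty.
Qed.

Lemma valuationD_gt (t : \bar R) x y : (t < v x -> t < v y -> t < v (x + y)%R)%E.
Proof.
by move=> tx ty; apply: lt_le_trans (valuationD hv x y); rewrite lt_min tx ty.
Qed.

Lemma valuationB_ge (t : \bar R) x y : (t <= v x -> t <= v y -> t <= v (x - y)%R)%E.
Proof. by move=> tx ty; apply: valuationD_ge; rewrite ?valuationN. Qed.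

Lemma valuationB_gt (t : \bar R) x y : (t < v x -> t < v y -> t < v (x - y)%R)%E.
Proof. by move=> tx ty; apply: valuationD_gt; rewrite ?valuationN. Qed.

Lemma valuationD_eq x y : (v x < v y)%E -> v (x + y) = v x.
Proof.
move=> xy; apply/eqP; rewrite eq_le valuationD_ge ?(ltW xy)// andbT leNgt.
apply/negP => h; have : (v x < v (x + y - y)%R)%E by apply: valuationB_gt.
by rewrite addrK ltxx.
Qed.

Lemma valuationB_eq x y : (v x < v y)%E -> v (x - y) = v x.
Proof. by move=> xy; apply: valuationD_eq; rewrite valuationN. Qed.

Lemma valuationBC x y : v (x - y) = v (y - x).
Proof. by rewrite -valuationN opprB. Qed.

Lemma valuationX x (a : R) n : v x = a%:E -> v (x ^+ n) = (n%:R * a)%:E.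
Proof.
move=> vx; elim: n => [|n IH]; first by rewrite expr0 valuation1 mul0r.
by rewrite exprS (valuationM hv) IH vx -EFinD -natr1 mulrDl mul1r addrC.
Qed.

Lemma valuationV x (a : R) : v x = a%:E -> v x^-1 = (- a)%:E.
Proof.
move=> vx; have x0 := valuation_neq0 vx.
have /valuation_EFin[b vb] : x^-1 != 0 by rewrite invr_eq0.
have := valuationM hv x x^-1; rewrite mulfV// valuation1 vx vb -EFinD => -[ab].
by congr EFin; lra.
Qed.

Lemma valuationXz x (a : R) (n : int) : v x = a%:E -> v (x ^ n) = (n%:~R * a)%:E.
Proof.
case: n => n vx; first by rewrite -exprnP (valuationX _ vx).
rewrite NegzE -exprz_inv -exprnP (valuationX _ (valuationV vx)).
by rewrite mulrN mulrNz mulNr.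
Qed.

Lemma valuation_prod (I : Type) (r : seq I) (P : pred I) (f : I -> E) :
  v (\prod_(i <- r | P i) f i) = (\sum_(i <- r | P i) v (f i))%E.
Proof. by apply: big_morph; [exact: (valuationM hv)|exact: valuation1]. Qed.

Lemma valuation_sum_ge (t : \bar R) (I : Type) (r : seq I) (P : pred I) (f : I -> E) :
  (forall i, P i -> (t <= v (f i))%E) -> (t <= v (\sum_(i <- r | P i) f i)%R)%E.
Proof.
move=> h; elim/big_ind : _ => //; first by rewrite (valuation0 hv) leey.
by move=> x y; exact: valuationD_ge.
Qed.

Lemma valuationM_ge0 x y : (0 <= v x -> 0 <= v y -> 0 <= v (x * y)%R)%E.
Proof. by move=> x0 y0; rewrite (valuationM hv) adde_ge0. Qed.

Lemma valuationM_gt0 x y : (0 < v x -> 0 <= v y -> 0 < v (x * y)%R)%E.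
Proof. by move=> x0 y0; rewrite (valuationM hv) (lt_le_trans x0)// leeDl. Qed.

Lemma valuation_coef_prod_ge0 (us : seq E) i : {in us, forall u, (0 <= v u)%E} ->
  (0 <= v (\prod_(u <- us) ('X - u%:P))`_i)%E.
Proof.
elim: us i => [|u us IH] i h.
  by rewrite big_nil coef1; case: eqP; rewrite ?valuation1 ?(valuation0 hv) ?leey.
have {}IH j := IH j (fun w wus => h w (mem_behead (s := u :: us) wus)).
rewrite big_cons mulrBl coefB coefXM coefCM; apply: valuationB_ge.
  by case: ifP => // _; rewrite (valuation0 hv) leey.
by apply: valuationM_ge0 => //; apply: h; rewrite mem_head.
Qed.

Lemma valuation_horner_ge0 (f : {poly E}) x :
  (forall i, (0 <= v f`_i)%E) -> (0 <= v x)%E -> (0 <= v f.[x])%E.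
Proof.
move=> f0 x0; rewrite horner_coef; apply: valuation_sum_ge => i _.
apply: valuationM_ge0 => //; elim: (i : nat) => [|n IH]; first by rewrite expr0 valuation1.
by rewrite exprS valuationM_ge0.
Qed.

Lemma valuation_deriv_ge0 (f : {poly E}) i :
  (forall i, (0 <= v f`_i)%E) -> (0 <= v f^`()`_i)%E.
Proof.
move=> f0; rewrite coef_deriv -[i.+1]card_ord -sumr_const.
exact: valuation_sum_ge.
Qed.

End Valuation.

(** * Hensel's lemma for a dominant root *)

Lemma prod_XsubC_scale (E : fieldType) (e : E) (us : seq E) : e != 0 ->
  \prod_(u <- us) ('X - (u / e)%:P) =
  e^-1 ^+ size us *: ((\prod_(u <- us) ('X - u%:P)) \Po (e *: 'X)).
Proof.
move=> e0; elim: us => [|u us IH].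
  by rewrite !big_nil expr0 scale1r rmorph1.
rewrite !big_cons IH comp_polyM -scalerAr /= exprSr -scalerA; congr (_ *: _).
rewrite scalerAl; congr (_ * _).
rewrite comp_polyB comp_polyX comp_polyC scalerBr scalerA mulVf// scale1r.
by rewrite -mul_polyC -polyCM mulrC.
Qed.

Section Hensel.
Variables (R : realType) (K E : fieldType) (vK : K -> \bar R) (v : E -> \bar R).
Variable iota : {rmorphism K -> E}.
Hypotheses (hH : henselian vK) (hv : valuation v).
Hypothesis hext : forall a, v (iota a) = vK a.

(* G has reduction X^n (X - 1), so Hensel applies at its simple root 1. *)
Lemma hensel_near1 (u0 : E) (us : seq E) (G : {poly K}) :
  map_poly iota G = \prod_(u <- u0 :: us) ('X - u%:P) ->
  (0 < v (1 - u0)%R)%E -> {in us, forall u, (0 < v u)%E} ->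
  exists b, u0 = iota b.
Proof.
move=> hG hu0 hus.
have v1 := valuation1 hv.
have vu0 : v u0 = 0%E.
  have -> : u0 = 1 - (1 - u0) by ring.
  by rewrite (valuationB_eq hv) ?v1.
have hall : {in u0 :: us, forall u, (0 <= v u)%E}.
  by move=> u; rewrite inE => /predU1P[->|/hus/ltW//]; rewrite vu0.
have hus' : {in us, forall u, (0 <= v u)%E} by move=> u /hus/ltW.
set Q := \prod_(u <- us) ('X - u%:P).
have vQ1 : v Q.[1] = 0%E.
  rewrite /Q horner_prod (valuation_prod hv) big_seq big1// => u uus.
  by rewrite hornerXsubC (valuationB_eq hv) v1// hus.
have vQ'1 : (0 <= v Q^`().[1])%E.
  apply: (valuation_horner_ge0 hv); last by rewrite v1.
  by move=> i; apply: (valuation_deriv_ge0 hv) => j; exact: (valuation_coef_prod_ge0 hv).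
have hG' : map_poly iota G = ('X - u0%:P) * Q by rewrite hG big_cons.
have [] := hH (f := G) (a := 1).
- by rewrite -(map_monic iota) hG monic_prod_XsubC.
- by move=> i; rewrite -hext -coef_map hG; exact: (valuation_coef_prod_ge0 hv).
- by rewrite -hext rmorph1 v1.
- rewrite -hext -horner_map rmorph1 hG' hornerM hornerXsubC.
  by apply: (valuationM_gt0 hv); rewrite ?vQ1.
- rewrite -hext -horner_map -deriv_map rmorph1 hG' derivM derivXsubC.
  rewrite mul1r hornerD hornerM hornerXsubC (valuationD_eq hv)// vQ1.
  exact: (valuationM_gt0 hv).
move=> b [rb vb]; exists b.
(* The roots in [us] have positive valuation, whereas [iota b] is congruent to 1 and has valuation
   0; hence [iota b] can only be [u0]. *)
have : root (map_poly iota G) (iota b) by rewrite fmorph_root.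
rewrite hG root_prod_XsubC inE => /predU1P[//|/hus].
have -> : iota b = 1 + iota (b - 1) by rewrite rmorphB rmorph1; ring.
by rewrite (valuationD_eq hv) v1 ?ltxx// hext.
Qed.

(** The sum [S] of all the roots is minus the subleading coefficient of [G], so it lies in K, and it
    differs from [u0] by a term of larger valuation. Dividing every root by [S] gives a polynomial
    over K with one root close to 1 and the others of positive valuation, which is the case of
    [hensel_near1]. *)
Lemma hensel_dominant (u0 : E) (us : seq E) (G : {poly K}) :
  map_poly iota G = \prod_(u <- u0 :: us) ('X - u%:P) ->
  {in us, forall u, (v u0 < v u)%E} -> u0 != 0 -> exists b, u0 = iota b.
Proof.
move=> hG hus u00.
have [a va] := valuation_EFin hv u00.
pose S := \sum_(u <- u0 :: us) u.
have vS' : (v u0 < v (\sum_(u <- us) u)%R)%E.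
  rewrite big_seq; elim/big_ind : _ => //; first by rewrite (valuation0 hv) va ltry.
  by move=> x y; exact: (valuationD_gt hv).
have vS : v S = a%:E by rewrite /S big_cons (valuationD_eq hv).
have S0 : S != 0 := valuation_neq0 hv vS.
have [e eS] : exists e, S = iota e.
  exists (- G`_(size us)); rewrite rmorphN -coef_map hG.
  by have -> := @coefPn_prod_XsubC _ (u0 :: us) isT; rewrite opprK.
have vdiv u : (v u0 < v u)%E -> (0 < v (u / S)%R)%E.
  rewrite (valuationM hv) (valuationV hv vS) va.
  have [->|/(valuation_EFin hv)[t ->]] := eqVneq u 0; first by rewrite (valuation0 hv) addye ?ltry.
  by rewrite -EFinD !lte_fin subr_gt0.
have [] := @hensel_near1 (u0 / S) [seq u / S | u <- us]
  ((e^-1 ^+ (size us).+1) *: (G \Po (e *: 'X))).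
- rewrite map_polyZ map_comp_poly map_polyZ map_polyX hG.
  rewrite rmorphXn fmorphV -eS.
  rewrite -(prod_XsubC_scale (u0 :: us) S0).
  by rewrite -(big_map (fun u => u / S) xpredT (fun w => 'X - w%:P)).
- have -> : 1 - u0 / S = (\sum_(u <- us) u) / S.
    by rewrite -(divff S0) -mulrBl /S big_cons addrC addKr.
  exact: vdiv vS'.
- by move=> _ /mapP[u /hus uus ->]; exact: vdiv.
move=> b hb; exists (b * e).
by rewrite rmorphM -eS -hb divfK.
Qed.

End Hensel.

(** * Symmetric functions of the roots *)

Lemma mmap_comp_mpoly (n k : nat) (A : comNzRingType) (B : comNzRingType)
    (f : {rmorphism A -> B}) (h : 'I_k -> B) (S : n.-tuple {mpoly A[k]})
    (t : {mpoly A[n]}) :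
  mmap f h (t \mPo S) = mmap f (fun i => mmap f h (tnth S i)) t.
Proof.
rewrite /comp_mpoly [in LHS]/(mmap (mpolyC k (R:=A))) rmorph_sum.
apply: eq_bigr => m _; rewrite rmorphM /= mmapC; congr (_ * _).
by rewrite rmorph_prod; apply: eq_bigr => i _; rewrite rmorphXn.
Qed.

(** A permutation of the roots only permutes the factors, so the product is symmetric in the roots.
    It is therefore a polynomial in the elementary symmetric functions, whose values are, up to
    sign, coefficients of [f]. The variable of [G] is absorbed in the coefficient ring
    [{poly K}]. *)
Lemma prod_subsets_over (K E : fieldType) (iota : {rmorphism K -> E}) (n j : nat)
    (y : 'I_n -> E) (f : {poly K}) :
  map_poly iota f = \prod_(i < n) ('X - (y i)%:P) ->
  exists G : {poly K}, map_poly iota G =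
    \prod_(I : {set 'I_n} | #|I| == j) ('X - (\prod_(i in I) y i)%:P).
Proof.
move=> hf.
pose P : {mpoly {poly K}[n]} :=
  \prod_(I : {set 'I_n} | #|I| == j) ('X%:MP - \prod_(i in I) 'X_i).
have [t [tP _]] : {t : {mpoly {poly K}[n]} |
    t \mPo [tuple mesym n {poly K} i.+1 | i < n] = P /\
    (mweight t <= mmeasure mdeg P)%N}.
  apply: sym_fundamental; apply/issymP => s.
  rewrite /P rmorph_prod /= (reindex_inj (imset_inj (@perm_inj _ s^-1%g))) /=.
  apply: eq_big => [I|I _]; first by rewrite card_imset//; exact: perm_inj.
  rewrite rmorphB /= /msym mmapC rmorph_prod; congr (_ - _).
  rewrite big_imset /=; last by move=> ? ? _ _; exact: perm_inj.
  by apply: eq_bigr => i _; rewrite mmapX mmap1U permKV.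
pose ph := mmap (map_poly iota) (fun i => (y i)%:P) : {mpoly {poly K}[n]} -> {poly E}.
have hsym k : (k <= n)%N ->
    ph (mesym n _ k) = map_poly iota ((-1) ^+ k * f`_(n - k))%:P.
  move=> kn; have -> : ph (mesym n _ k) = ((mesym n E k).@[y])%:P.
    rewrite /ph /mesym rmorph_sum [X in _ = X%:P]raddf_sum [RHS]rmorph_sum.
    apply: eq_bigr => I _.
    rewrite rmorph_prod [X in _ = X%:P]rmorph_prod [RHS]rmorph_prod.
    apply: eq_bigr => i _.
    by rewrite /= mmapX mmap1U mevalXU.
  rewrite map_polyC /= rmorphM rmorphXn rmorphN rmorph1 -coef_map hf.
  have := @mroots_coeff E n [tuple y i | i < n] (Ordinal (kn : (k < n.+1)%N)).
  rewrite big_map big_enum /= => ->.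
  rewrite mulrA -exprD addnn -mul2n exprM sqrrN expr1n expr1n mul1r.
  by congr (_%:P); apply: meval_eq => i; rewrite tnth_mktuple.
exists (t.@[fun i => ((-1) ^+ i.+1 * f`_(n - i.+1))%:P]).
have -> : \prod_(I : {set 'I_n} | #|I| == j) ('X - (\prod_(i in I) y i)%:P) = ph P.
  rewrite /ph /P rmorph_prod; apply: eq_bigr => I _.
  rewrite rmorphB /= mmapC /= map_polyX !rmorph_prod; congr (_ - _).
  by apply: eq_bigr => i _; rewrite /= mmapX mmap1U.
rewrite -tP /ph mmap_comp_mpoly /mmap /meval rmorph_sum.
apply: eq_bigr => m _; rewrite rmorphM rmorph_prod; congr (_ * _).
apply: eq_bigr => i _.
by rewrite rmorphXn tnth_mktuple; congr (_ ^+ _); exact/esym/hsym.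
Qed.

(** * Descent to K of the factor carrying the roots of minimal valuation *)

Section FactorDescent.
Variables (R : realType) (K E : fieldType) (vK : K -> \bar R) (v : E -> \bar R).
Variable iota : {rmorphism K -> E}.
Hypotheses (hH : henselian vK) (hv : valuation v).
Hypothesis hext : forall a, v (iota a) = vK a.

Lemma valuation_prod_ge (n : nat) (y : 'I_n -> E) (a : R) (A : {set 'I_n}) :
  {in A, forall i, (a%:E <= v (y i))%E} ->
  ((a *+ #|A|)%:E <= v (\prod_(i in A) y i)%R)%E.
Proof.
move=> h; rewrite (valuation_prod hv) -sumr_const -sumEFin.
exact: lee_sum.
Qed.

(* Among the products of #|I0| of the roots, the one over I0 has strictly smaller
   valuation than all the others. *)
Lemma prod_min_over (n : nat) (y : 'I_n -> E) (f : {poly K}) (I0 : {set 'I_n})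
    (a : R) :
  map_poly iota f = \prod_(i < n) ('X - (y i)%:P) ->
  {in I0, forall i, v (y i) = a%:E} ->
  (forall i, i \notin I0 -> (a%:E < v (y i))%E) ->
  exists b, \prod_(i in I0) y i = iota b.
Proof.
move=> hf hI0 hI0c.
have ge_a i : (a%:E <= v (y i))%E.
  by have [/hI0 ->//|/hI0c/ltW] := boolP (i \in I0).
have vI0 : v (\prod_(i in I0) y i)%R = (a *+ #|I0|)%:E.
  rewrite (valuation_prod hv) -sumr_const -sumEFin; exact: eq_bigr.
have [G hG] := prod_subsets_over #|I0| hf.
pose other := enum [pred I : {set 'I_n} | (#|I| == #|I0|) && (I != I0)].
refine (hensel_dominant hH hv hext (G := G)
  (us := [seq \prod_(i in A) y i | A : {set 'I_n} <- other]) _ _ _).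
- by rewrite hG (bigD1 I0)//= big_cons big_map big_enum.
- move=> _ /mapP[J + ->]; rewrite mem_enum => /andP[/eqP cJ nJ].
  (* A set [J] other than [I0] of the same cardinality contains an index outside [I0]; this factor
     makes the inequality strict, the others having valuation at least [a]. *)
  have /subsetPn[i iJ iI0] : ~~ (J \subset I0).
    by apply: contra nJ => sJ; rewrite eqEcard sJ cJ /=.
  rewrite vI0 -cJ (cardsD1 i J) iJ add1n mulrS.
  have -> : \prod_(i in J) y i = y i * \prod_(k in J :\ i) y k.
    rewrite (bigD1 i)//=; congr (_ * _); apply: eq_bigl => k.
    by rewrite in_setD1 andbC.
  rewrite (valuationM hv) EFinD lte_leD ?hI0c//.
  exact: valuation_prod_ge.
- exact: (valuation_neq0 hv vI0).
Qed.

Lemma map_lagrange (n : nat) (x : nat -> K) (i : 'I_n) :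
  (0 < n)%N -> injective x ->
  map_poly iota (tnth (n.-lagrange x) i) = tnth (n.-lagrange (iota \o x)) i.
Proof.
move=> n0 xI.
rewrite !lagrangeE//; last exact: inj_comp (fmorph_inj _) xI.
rewrite rmorphM /= map_polyC /= fmorphV -horner_map rmorph_prod.
have -> : \prod_(j < n | j != i) map_poly iota ('X - (x j)%:P) =
    \prod_(j < n | j != i) ('X - (iota (x j))%:P).
  by apply: eq_bigr => j _; exact: map_polyXsubC.
by [].
Qed.

(** Lagrange interpolation recovers [g] from its values, and the basis polynomials attached to
    points of K have coefficients in K. *)
Lemma poly_over_of_values (n : nat) (x : nat -> K) (g : {poly E}) :
  injective x -> (size g <= n)%N ->
  (forall i : 'I_n, exists b, g.[iota (x i)] = iota b) ->
  exists h : {poly K}, map_poly iota h = g.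
Proof.
move=> xI sg /fin_all_exists[b hb].
have [n0|n_gt0] := posnP n.
  exists 0; rewrite rmorph0; apply/esym/eqP.
  by rewrite -size_poly_eq0 -leqn0 -n0.
exists (\sum_(i < n) (b i)%:P * tnth (n.-lagrange x) i).
rewrite (lagrange_gen n_gt0 (inj_comp (fmorph_inj iota) xI) sg) rmorph_sum.
apply: eq_bigr => i _.
by rewrite rmorphM /= map_polyC /= map_lagrange//= hb.
Qed.

(* Adding an element t of K with v(t) > a to all the roots does not change which
   ones have minimal valuation, so the values of the factor at all such -t lie
   in K; interpolating gives its coefficients. *)
Lemma min_factor_over (n : nat) (y : 'I_n -> E) (f : {poly K}) (I0 : {set 'I_n})
    (a : R) (pi : K) : vK pi = 1%E ->
  map_poly iota f = \prod_(i < n) ('X - (y i)%:P) ->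
  {in I0, forall i, v (y i) = a%:E} ->
  (forall i, i \notin I0 -> (a%:E < v (y i))%E) ->
  exists g : {poly K}, map_poly iota g = \prod_(i in I0) ('X - (y i)%:P).
Proof.
move=> hpi hf hI0 hI0c.
have vpi : v (iota pi) = 1%:E by rewrite hext.
have vpin k : v (iota (pi ^+ k)) = k%:R%:E.
  by rewrite rmorphXn (valuationX hv _ vpi) mulr1.
(* As [N] exceeds [a], every [pi ^+ (N + k)] has valuation greater than [a]. These valuations are
   distinct, so the interpolation points are distinct too. *)
pose N := (Num.truncn `|a|).+1.
have aN : a < N%:R.
  by apply: le_lt_trans (ler_norm a) _; exact: truncnS_gt.
apply: (@poly_over_of_values #|I0|.+1 (fun k => - pi ^+ (N + k))).
- move=> k l /oppr_inj /(congr1 (v \o iota)) /=; rewrite !vpin => -[].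
  by move=> /eqP; rewrite eqr_nat eqn_add2l => /eqP.
- by rewrite -big_enum size_prod_XsubC -cardE.
move=> k; set t := pi ^+ (N + k).
have vt : (a%:E < v (iota t))%E.
  by rewrite vpin lte_fin (lt_le_trans aN)// ler_nat leq_addr.
have hft : map_poly iota (f \Po ('X - t%:P)) =
    \prod_(i < n) ('X - (y i + iota t)%:P).
  rewrite map_comp_poly hf rmorph_prod; apply: eq_bigr => i _ /=.
  rewrite comp_polyB comp_polyX comp_polyC map_polyXsubC.
  by rewrite polyCD opprD addrAC addrA.
have [||b hb] := prod_min_over (I0 := I0) (a := a) hft.
- by move=> i iI0; rewrite (valuationD_eq hv) hI0.
- by move=> i iI0; apply: (valuationD_gt hv) => //; exact: hI0c.
(* The value of the factor at [-t] is the product of the [-(y i + t)] over [I0], whence the sign. *)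
exists ((-1) ^+ #|I0| * b).
rewrite horner_prod rmorphM rmorphXn !rmorphN rmorph1 -hb -prodrN.
by apply: eq_bigr => i _; rewrite hornerXsubC; ring.
Qed.

End FactorDescent.

(** * Integrality of [r v(z)] for [z] in an extension of degree [r] *)

Section ExtensionValuation.
Variables (R : realType) (K : fieldType) (E : closedFieldType).
Variables (vK : K -> \bar R) (v : E -> \bar R) (iota : {rmorphism K -> E}).
Hypotheses (hZ : value_group_Z vK) (hH : henselian vK) (hv : valuation v).
Hypothesis hext : forall a, v (iota a) = vK a.

(** For [A] the matrix of multiplication by [z] and [u] the column of a basis, this passes between
    polynomials killing [z] and polynomials killing [A]. *)
Lemma mulmx_horner_eigen (n : nat) (A : 'M[K]_n.+1) (z : E) (u : 'cV[E]_n.+1)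
    (g : {poly K}) :
  map_mx iota A *m u = z *: u ->
  map_mx iota (horner_mx A g) *m u = (map_poly iota g).[z] *: u.
Proof.
move=> hA; elim/poly_ind: g => [|g c IH].
  by rewrite !rmorph0 mul0mx horner0 scale0r.
rewrite rmorphD rmorphM /= horner_mx_X horner_mx_C map_mxD map_mxM.
rewrite map_scalar_mx mulmxDl mul_scalar_mx -mulmxA hA -scalemxAr IH scalerA.
rewrite rmorphD rmorphM /= map_polyX map_polyC hornerMXaddC.
by rewrite scalerDl [z * _]mulrC.
Qed.

(* If the roots of the characteristic polynomial did not all have the same
   valuation, it would factor over K as g h with g and h having no common
   root; g or h would kill z, hence vanish at every eigenvalue. *)
Lemma eigenvalues_same_valuation (n : nat) (A : 'M[K]_n.+1) (z : E)
    (ys : seq E) : z != 0 ->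
  (forall g : {poly K}, root (map_poly iota g) z -> horner_mx A g = 0) ->
  map_poly iota (char_poly A) = \prod_(y <- ys) ('X - y%:P) ->
  z \in ys -> {in ys, forall y, v y = v z}.
Proof.
move=> z0 hA hys zys.
have [pi _ vpi] := hZ.2 1.
pose m := size ys; pose y (i : 'I_m) := ys`_i.
have yP w : w \in ys -> exists i, w = y i.
  move=> wys; have ltw : (index w ys < m)%N by rewrite index_mem.
  by exists (Ordinal ltw); rewrite /y nth_index.
have hy : map_poly iota (char_poly A) = \prod_(i < m) ('X - (y i)%:P).
  by rewrite hys (big_nth 0) big_mkord.
(* A polynomial over K vanishing at [z] kills [A], so it is divisible by the minimal polynomial of
   [A], which vanishes at every eigenvalue. *)
have root_all (g : {poly K}) i :
    root (map_poly iota g) z -> root (map_poly iota g) (y i).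
  move=> /hA/mxminpoly_min; rewrite -(dvdp_map iota) => dv.
  have : root (map_poly iota (mxminpoly A)) (y i).
    rewrite -mxminpoly_map -eigenvalue_root_min eigenvalue_root_char.
    by rewrite -map_char_poly hy (bigD1 i)//= rootM root_XsubC eqxx.
  by rewrite -!dvdp_XsubCl => /dvdp_trans; exact.
have root_in (J : {set 'I_m}) w :
    root (\prod_(i in J) ('X - (y i)%:P)) w -> exists2 i, i \in J & w = y i.
  rewrite /root horner_prod => /prodf_eq0[i iJ].
  by rewrite hornerXsubC subr_eq0 => /eqP; exists i.
have [iz ziz] := yP z zys.
have [i0 _ imin] := @arg_minP _ _ _ iz xpredT (v \o y) isT.
have [a va] : exists a : R, v (y i0) = a%:E.
  apply: (valuation_EFin hv); apply/eqP => y0.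
  have := imin iz isT; rewrite /= y0 (valuation0 hv) -ziz.
  by have [b ->] := valuation_EFin hv z0.
pose I0 := [set i | v (y i) == a%:E].
have hI0 : {in I0, forall i, v (y i) = a%:E} by move=> i; rewrite inE => /eqP.
have hI0c i : i \notin I0 -> (a%:E < v (y i))%E.
  by rewrite inE => ne; rewrite lt_neqAle eq_sym ne -va; exact: imin.
have [g hg] := min_factor_over hH hv hext vpi hy hI0 hI0c.
suff gz : root (map_poly iota g) z.
  have same i : v (y i) = a%:E.
    by have := root_all g i gz; rewrite hg => /root_in[j /hI0 vj ->].
  by move=> w /yP[i ->]; rewrite ziz !same.
have [h hh] : exists h : {poly K},
    map_poly iota h = \prod_(i in ~: I0) ('X - (y i)%:P).
  exists (char_poly A %/ g); rewrite map_divp hg hy.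
  rewrite (bigID (mem I0))/= mulKp; last first.
    by apply/prodf_neq0 => i _; rewrite polyXsubC_eq0.
  by apply: eq_bigl => i; rewrite in_setC.
have : root (map_poly iota (char_poly A)) z by rewrite hys root_prod_XsubC.
rewrite hy (bigID (mem I0))/= -hg.
rewrite (eq_bigl (mem (~: I0))); last by move=> i; rewrite /= in_setC.
(* If [z] were a root of [h], so would be [y i0], of valuation [a]; but all roots of [h] have
   valuation greater than [a]. *)
rewrite -hh rootM => /orP[//|/(root_all h i0)].
rewrite hh => /root_in[j]; rewrite inE => /hI0c + yj.
by rewrite -yj va ltxx.
Qed.

(** Multiplication by [z] has a matrix [B] over K with eigenvalue [z]. All [r] roots of its
    characteristic polynomial have the valuation of [z], so the constant coefficient, which is the
    determinant up to sign, is an element of K of valuation [r v(z)]. *)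
Lemma valuation_extension_degree (M : E -> Prop) (r : nat) (z : E) (a : R) :
  extension_degree iota M r -> (0 < r)%N -> (forall x, M x -> M (z * x)) ->
  v z = a%:E -> exists m : int, r%:R * a = m%:~R.
Proof.
case: r => [//|r] [e [Me free span]] _ Mz vz.
have /fin_all_exists[A hA] : forall i, exists c : 'I_r.+1 -> K,
    z * e i = \sum_j iota (c j) * e j.
  by move=> i; apply/span/Mz.
pose B := \matrix_(i, j) A i j.
pose u : 'cV[E]_r.+1 := \col_i e i.
have hB : map_mx iota B *m u = z *: u.
  apply/matrixP => i j; rewrite !mxE hA; apply: eq_bigr => l _.
  by rewrite !mxE.
(* Linear independence of the basis over K: a matrix over K is determined by its action on [u]. *)
have free0 C : map_mx iota C *m u = 0 -> C = 0 :> 'M[K]_r.+1.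
  move=> /matrixP C0; apply/matrixP => i j; rewrite mxE.
  apply: (free (fun j => C i j)); have := C0 i ord0; rewrite !mxE => C0i; rewrite -[RHS]C0i.
  by apply: eq_bigr => l _; rewrite !mxE.
have u0 : u != 0.
  apply/eqP => u0; have : (1%:M : 'M[K]_r.+1) = 0.
    by apply: free0; rewrite u0 mulmx0.
  by move/eqP; rewrite oner_eq0.
have hgz (g : {poly K}) : root (map_poly iota g) z -> horner_mx B g = 0.
  by move=> /eqP gz; apply: free0; rewrite (mulmx_horner_eigen _ hB) gz scale0r.
have [ys hys] := closed_field_poly_normal (map_poly iota (char_poly B)).
rewrite lead_coef_map (monicP (char_poly_monic B)) rmorph1 scale1r in hys.
have zys : z \in ys.
  rewrite -root_prod_XsubC -hys.
  have := mulmx_horner_eigen (char_poly B) hB.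
  rewrite Cayley_Hamilton map_mx0 mul0mx => /esym/eqP.
  by rewrite scaler_eq0 (negPf u0) orbF.
have same := eigenvalues_same_valuation (valuation_neq0 hv vz) hgz hys zys.
have sys : size ys = r.+1.
  have := size_char_poly B.
  by rewrite -(size_map_poly iota) hys size_prod_XsubC => -[].
have vdet : vK (char_poly B).[0] = (r.+1%:R * a)%:E.
  rewrite -hext -horner_map rmorph0 hys horner_prod (valuation_prod hv).
  rewrite big_seq (eq_bigr (fun=> a%:E)); last first.
    by move=> y /same vy; rewrite hornerXsubC sub0r (valuationN hv) vy.
  by rewrite -big_seq sumEFin big_const_seq count_predT sys iter_addr_0 mulr_natl.
have [|m hm] := hZ.1 (char_poly B).[0].
  by rewrite -(fmorph_eq0 iota); apply: (valuation_neq0 hv); rewrite hext vdet.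
by exists m; move: hm; rewrite vdet => -[].
Qed.

End ExtensionValuation.

(** * A vertex of the Newton polygon of a shifted polynomial *)

Section NewtonVertex.
Variables (R : realType) (E : fieldType) (v : E -> \bar R).
Hypothesis hv : valuation v.

(* The bound says that the Newton polygon lies above the line of slope - mu
   through its vertex at k = count P ws. *)
Lemma newton_vertex (P : pred E) (mu : R) (ws : seq E) :
  {in ws, forall w, P w -> (mu%:E <= v w)%E} ->
  {in ws, forall w, ~~ P w -> (v w < mu%:E)%E} ->
  let Q := \prod_(w <- ws) ('X - w%:P) in let k := count P ws in
  exists V : R,
  [/\ (\sum_(w <- ws | ~~ P w) v w)%E = V%:E, v Q`_k = V%:E,
      forall i, ((V + k%:R * mu - i%:R * mu)%:E <= v Q`_i)%E
    & forall i, (k < i)%N -> ((V + k%:R * mu - i%:R * mu)%:E < v Q`_i)%E].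
Proof.
elim: ws => [|w ws IH] hP hN.
  exists 0; rewrite !big_nil /=; split => //.
  - by rewrite coef1 (valuation1 hv).
  - move=> [|i]; rewrite coef1 /= ?(valuation0 hv) ?leey//.
    by rewrite (valuation1 hv) !mul0r addr0 subr0.
  - by move=> [|i]; rewrite // coef1 /= (valuation0 hv) ltry.
have [||V [hV hk hle hlt]] := IH.
- by move=> x xs; apply: hP; rewrite inE xs orbT.
- by move=> x xs; apply: hN; rewrite inE xs orbT.
set Q := \prod_(w <- ws) ('X - w%:P) in hk hle hlt *.
set k := count P ws in hk hle hlt *.
rewrite !big_cons -/Q /= -/k hV.
have coefE i : (('X - w%:P) * Q)`_i = (if i is j.+1 then Q`_j else 0) - w * Q`_i.
  by rewrite mulrBl coefB coefXM coefCM; case: i.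
have w_in : w \in w :: ws by rewrite mem_head.
have [Pw|Pw] := boolP (P w).
(* A root satisfying [P] moves the vertex one index to the right at the same height: the shifted
   coefficient dominates there. *)
- have mw := hP w w_in Pw.
  exists V; rewrite /= add1n; split => //.
  + rewrite coefE (valuationB_eq hv) hk//.
    rewrite (valuationM hv).
    apply: le_lt_trans (lee_ltD _ mw (hlt k.+1 (ltnSn k))) => //.
    by rewrite -EFinD lee_fin -natr1; lra.
  + move=> i; rewrite coefE; apply: (valuationB_ge hv).
      case: i => [|j]; first by rewrite (valuation0 hv) leey.
      by apply: le_trans (hle j); rewrite lee_fin -!natr1; lra.
    rewrite (valuationM hv); apply: le_trans (leeD mw (hle i)).
    by rewrite -EFinD lee_fin -natr1; lra.
  + move=> [//|j]; rewrite ltnS => kj; rewrite coefE; apply: (valuationB_gt hv).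
      by apply: le_lt_trans (hlt j kj); rewrite lee_fin -!natr1; lra.
    rewrite (valuationM hv).
    apply: le_lt_trans (lee_ltD _ mw (hlt j.+1 (leqW kj))) => //.
    by rewrite -EFinD lee_fin -!natr1; lra.
(* A root of valuation [b] below [mu] keeps the index of the vertex and adds [b] to its height: here
   the term multiplied by [w] dominates. *)
- have := hN w w_in Pw.
  have [b vb] : exists b : R, v w = b%:E.
    by apply: (valuation_EFin hv); exact: (valuation_lt_neq0 hv (hN w w_in Pw)).
  rewrite vb lte_fin => bmu.
  have shift_gt i : ((b + V + k%:R * mu - i%:R * mu)%:E <
      v (if i is j.+1 then Q`_j else 0))%E.
    case: i => [|j]; first by rewrite (valuation0 hv) ltry.
    by apply: lt_le_trans (hle j); rewrite lte_fin -natr1; lra.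
  exists (b + V); rewrite /= add0n; split.
  + by rewrite EFinD.
  + rewrite coefE -(valuationN hv) opprB (valuationB_eq hv).
      by rewrite (valuationM hv) vb hk.
    rewrite (valuationM hv) vb hk; apply: le_lt_trans (shift_gt k).
    by rewrite -EFinD lee_fin; lra.
  + move=> i; rewrite coefE; apply: (valuationB_ge hv); first exact/ltW.
    rewrite (valuationM hv) vb; apply: le_trans (leeD (lexx _) (hle i)).
    by rewrite -EFinD lee_fin; lra.
  + move=> i ki; rewrite coefE; apply: (valuationB_gt hv); first exact: shift_gt.
    rewrite (valuationM hv) vb; apply: le_lt_trans (lee_ltD _ (lexx _) (hlt i ki)) => //.
    by rewrite -EFinD lee_fin; lra.
Qed.

(** The witness is the vertex coefficient of [F(X + g)], whose roots are the [a - g]. Writing the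
    sum as the valuation of an element of K makes it an integer as soon as it is finite. *)
Lemma shifted_coef_valuation (K : fieldType) (iota : {rmorphism K -> E})
    (F : {poly K}) (rs : seq E) (g : K) (P : pred E) (mu : R) :
  map_poly iota F = iota (lead_coef F) *: \prod_(a <- rs) ('X - a%:P) ->
  {in rs, forall a, P a -> (mu%:E <= v (iota g - a)%R)%E} ->
  {in rs, forall a, ~~ P a -> (v (iota g - a)%R < mu%:E)%E} ->
  exists h : K, v (iota h) =
    (v (iota (lead_coef F)) + \sum_(a <- rs | ~~ P a) v (iota g - a)%R)%E.
Proof.
move=> hrs hP hN; pose T (x : E) := P (x + iota g).
have TE a : T (a - iota g) = P a by rewrite /T subrK.
have [||V [hV hk _ _]] := @newton_vertex T mu [seq a - iota g | a <- rs].
- by move=> _ /mapP[a ars ->]; rewrite TE (valuationBC hv); exact: hP.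
- by move=> _ /mapP[a ars ->]; rewrite TE (valuationBC hv); exact: hN.
exists ((F \Po ('X + g%:P))`_(count T [seq a - iota g | a <- rs])).
have -> : (\sum_(a <- rs | ~~ P a) v (iota g - a)%R)%E = V%:E.
  rewrite -hV big_map; apply: eq_big => [a|a _]; first by rewrite TE.
  by rewrite (valuationBC hv).
rewrite -hk -(valuationM hv) -coef_map map_comp_poly hrs comp_polyZ coefZ.
congr (v (_ * _`_ _)).
rewrite big_map rmorph_prod; congr polyseq; apply: eq_bigr => a _ /=.
rewrite comp_polyB comp_polyX comp_polyC rmorphD /= map_polyX map_polyC /=.
by rewrite polyCB opprB addrA.
Qed.

End NewtonVertex.

(** * Absolute values and the region [X_s] in terms of the valuation *)

Section AbsoluteValue.
Variables (R : realType) (c : R) (E : fieldType) (v : E -> \bar R).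
Hypotheses (hc : 1 < c) (hv : valuation v).

Lemma absv_lt x y : (absv c v x < absv c v y) = (v y < v x)%E.
Proof.
have c0 : 0 < c by rewrite (lt_trans ltr01).
have := valuation_neqNy hv x; have := valuation_neqNy hv y.
rewrite /absv; case: (v x) => [a| |//]; case: (v y) => [b| |//] _ _.
- rewrite /powR gt_eqF// ltr_expR ltr_pM2r ?ln_gt0// lte_fin.
  by rewrite ltrN2.
- by rewrite ltNge powR_ge0 ltNge leey.
- by rewrite powR_gt0// ltry.
- by rewrite !ltxx.
Qed.

Lemma absv_le x y : (absv c v x <= absv c v y) = (v y <= v x)%E.
Proof. by rewrite leNgt absv_lt leNgt. Qed.

(** The minimal distance to the roots is attained on the nonempty [s], so it is encoded by the
    common valuation [t]; the inequalities are reversed because [c > 1]. *)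
Lemma cluster_regionP (rs s : seq E) (x : E) : s != [::] -> {subset s <= rs} ->
  cluster_region c v rs s x <->
  exists t : \bar R, {in s, forall a, v (x - a) = t} /\
    {in rs, forall b, b \notin s -> (v (x - b) < t)%E}.
Proof.
case: s => [//|a0 s] _ srs; set S := a0 :: s; have a0S : a0 \in S by rewrite mem_head.
split=> [[h1 h2]|[t [h1 h2]]].
- exists (v (x - a0)); split=> [a aS|b brs bS].
    by apply/eqP; rewrite eq_le -!absv_le !h1// !lexx.
  by rewrite -absv_lt h1// h2.
- rewrite /cluster_region.
  have -> : root_distance c v rs x = absv c v (x - a0).
    have ge b : b \in rs -> absv c v (x - a0) <= absv c v (x - b).
      move=> brs; rewrite absv_le (h1 a0)//.
      by have [/h1 ->//|/(h2 b brs)/ltW] := boolP (b \in S).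
    apply/eqP; rewrite eq_le; apply/andP; split.
      by apply: ge_bigmin_seq => //; exact: srs.
    rewrite /root_distance big_seq; apply: le_bigmin => [|b]; last exact: ge.
    by apply: ge; move: (srs a0 a0S); case: (rs) => // d l _; rewrite mem_head.
  split=> [a aS|b brs bS]; last by rewrite absv_lt (h1 a0)// h2.
  by rewrite /absv !h1.
Qed.

End AbsoluteValue.

(** * Distance from [gamma] to the roots of the cluster *)

Section GammaConstruction.
Variables (R : realType) (c : R) (K E k : fieldType).
Variables (iota : {rmorphism K -> E}) (vK : K -> \bar R) (v : E -> \bar R).
Variables (red : K -> k) (pi : K) (rep : k -> K).
Hypotheses (hc : 1 < c) (hv : valuation v).
Hypothesis hext : forall a, v (iota a) = vK a.
Hypotheses (hred : residue_map vK red).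
Hypotheses (hrep : residue_representatives vK red rep) (hpi : vK pi = 1%E).

(** Representatives are integral, so each omitted term has valuation at least [(n0 + n) t]. The
    ultrametric inequality extends the bound to finite tails, and convergence extends it to [x]. *)
Lemma laurent_remainder (tau : E) (t : R) (b : int -> K) (n0 : int) (x : E) n :
  v tau = t%:E -> 0 <= t -> laurent_expansion iota v rep tau b n0 x ->
  (((n0 + n%:Z)%:~R * t)%:E <= v (x - laurent_sum iota tau b n0 n)%R)%E.
Proof.
move=> vtau t0 [brep _ lim].
have term j : (n <= j)%N -> (((n0 + n%:Z)%:~R * t)%:E <=
    v (iota (b (n0 + j%:Z)) * tau ^ (n0 + j%:Z))%R)%E.
  move=> nj; rewrite (valuationM hv) (valuationXz hv _ vtau) hext.
  have [a ->] := brep (n0 + j%:Z).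
  have [r0 _] := hrep.2 a.
  apply: le_trans (leeD r0 (lexx _)); rewrite add0e lee_fin ler_wpM2r//.
  by rewrite ler_int lerD2l lez_nat.
have tail d : (((n0 + n%:Z)%:~R * t)%:E <=
    v (laurent_sum iota tau b n0 (n + d) - laurent_sum iota tau b n0 n)%R)%E.
  elim: d => [|d IH]; first by rewrite addn0 subrr (valuation0 hv) leey.
  rewrite addnS /laurent_sum big_ord_recr /= addrAC.
  by apply: (valuationD_ge hv) => //; apply: term; rewrite leq_addr.
have [N hN] := lim ((n0 + n%:Z)%:~R * t).
have -> : x - laurent_sum iota tau b n0 n =
    (x - laurent_sum iota tau b n0 (n + N)) +
    (laurent_sum iota tau b n0 (n + N) - laurent_sum iota tau b n0 n) by ring.
by apply: (valuationD_ge hv) => //; apply/ltW/hN/leq_addl.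
Qed.

(** Each residue class has a single representative, so distinct representatives have distinct
    residues and their difference is a unit. *)
Lemma rep_sub_valuation x y a b : x = rep a -> y = rep b -> x <> y ->
  vK (x - y) = 0%E.
Proof.
move=> -> -> xy.
have [ra redra] := hrep.2 a; have [rb redrb] := hrep.2 b.
have d0 : (0 <= vK (rep a - rep b)%R)%E.
  by rewrite -hext rmorphB (valuationB_ge hv) ?hext.
apply/eqP; rewrite eq_le d0 andbT leNgt; apply/negP => /(residue_eq0 hred d0) red0.
apply: xy; congr rep; rewrite -redra -redrb.
by rewrite -{1}(subrK (rep b) (rep a)) (residueD hred)// red0 add0r.
Qed.

(** In the series case [a] and [a'] share the truncation [S] and differ in the next coefficient, so
    [v(a - S)] is at least [v(a - a')]. The distance from [a] to [a'] being the largest within [s],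
    each [v(a - d)] is also at least [v(a - a')]. For a single root both sides are [v(0)]. *)
Lemma gamma_close (rs s : seq E) (g : E) :
  gamma_construction c iota v pi rep rs s g ->
  exists a a', [/\ a \in s, a' \in s &
    {in s, forall d, (v (a - a')%R <= v (g - d)%R)%E}].
Proof.
case=> [a aS aall|tau m a a' b b' n0 n _ _ taum [_ tau0 _] aS a'S amax ea ea' bb' beq].
  by exists a, a; split => // d /aall ->.
have [t vt] : exists t : R, v tau = t%:E.
  (* With [tau = 0], the power [tau ^+ m] would have valuation 0 if [m = 0] and [+oo] otherwise,
     never the valuation 1 of [pi]. *)
  apply: (valuation_EFin hv); apply/eqP => tz.
  have := hext pi; rewrite hpi -taum tz expr0n; case: eqP => _ /=.
    by rewrite (valuation1 hv) => -[/eqP]; rewrite eq_sym oner_eq0.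
  by rewrite (valuation0 hv).
have t0 : 0 < t by rewrite vt lte_fin in tau0.
have [brep _ _] := ea; have [b'rep _ _] := ea'.
set S := laurent_sum iota tau b n0 n.
have SE : laurent_sum iota tau b' n0 n = S.
  by apply: eq_bigr => j _; rewrite beq// ltrD2l ltz_nat.
set D := ((n0 + n%:Z)%:~R * t)%:E.
have aD : (D <= v (a - S)%R)%E by apply: laurent_remainder (ltW t0) ea.
have vaa' : v (a - a') = D.
  (* One term further, the truncations differ by a single term, a unit times [tau ^ (n0 + n)], while
     both remainders have valuation greater than [D]. *)
  pose T := laurent_sum iota tau b n0 n.+1; pose T' := laurent_sum iota tau b' n0 n.+1.
  have DS : (D < ((n0 + n.+1%:Z)%:~R * t)%:E)%E.
    by rewrite lte_fin ltr_pM2r// ltr_int ltrD2l ltz_nat.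
  have aT : (D < v (a - T)%R)%E.
    by apply: lt_le_trans DS _; apply: laurent_remainder (ltW t0) ea.
  have aT' : (D < v (a' - T')%R)%E.
    by apply: lt_le_trans DS _; apply: laurent_remainder (ltW t0) ea'.
  have vTT' : v (T - T') = D.
    have -> : T - T' = iota (b (n0 + n%:Z) - b' (n0 + n%:Z)) * tau ^ (n0 + n%:Z).
      rewrite /T /T' /laurent_sum !big_ord_recr /= -!/(laurent_sum _ _ _ _ _).
      by rewrite SE -/S rmorphB; ring.
    have [x xE] := brep (n0 + n%:Z); have [x' x'E] := b'rep (n0 + n%:Z).
    rewrite (valuationM hv) hext (rep_sub_valuation xE x'E bb') add0e.
    exact: (valuationXz hv).
  have -> : a - a' = (T - T') + ((a - T) - (a' - T')) by ring.
  by rewrite (valuationD_eq hv) vTT'//; apply: (valuationB_gt hv).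
exists a, a'; split => // d dS.
have -> : S - d = (a - d) - (a - S) by ring.
apply: (valuationB_ge hv); last by rewrite vaa'.
by have := amax a d aS dS; rewrite (absv_le hc hv).
Qed.

End GammaConstruction.

(** * Congruences modulo [q] at the point and at [gamma] *)

Theorem lemma5p1 (R : realType)
  (K : fieldType) (vK : K -> \bar R) (k : closedFieldType) (red : K -> k)
  (p : nat)
  (hvK : valuation vK) (hZ : value_group_Z vK) (hH : henselian vK)
  (hred : residue_map vK red) (hp : has_characteristic k p)
  (Kbar : closedFieldType) (iota : {rmorphism K -> Kbar})
  (hKbar : algebraic_closure iota)
  (v : Kbar -> \bar R) (hv : valuation v) (hext : forall a, v (iota a) = vK a)
  (c : R) (hc : 1 < c)
  (q : nat) (hq : prime q) (hqp : q <> p)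
  (F : {poly K}) (hF : superelliptic q F)
  (rs : seq Kbar)
  (hrs : map_poly iota F =
         iota (lead_coef F) *: \prod_(a <- rs) ('X - a%:P))
  (htame : forall a, a \in rs -> tamely_ramified iota vK red v p a)
  (s : seq Kbar) (hs : cluster c v rs s) (hinv : galois_invariant iota s)
  (pi : K) (hpi : vK pi = 1%E)
  (rep : k -> K) (hrep : residue_representatives vK red rep)
  (gamma : K) (hgamma : gamma_construction c iota v pi rep rs s (iota gamma))
  (r : nat) (hr : ~~ (q %| r)%N) :
  (exists P : Kbar * Kbar,
     [/\ on_U iota q F rs P,
         extension_degree iota (adjoin iota [:: P.1; P.2]) r
       & cluster_region c v rs s P.1]) ->
  [\/ ~~ (q %| size s)%N,
      (q %| size s)%N /\ eq0_mod q (cluster_const v (iota (lead_coef F)) rs s),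
      cluster_region c v rs s 0 /\ eq0_mod q (vK F.[0])
    | cluster_region c v rs s (iota gamma) /\ eq0_mod q (vK F.[gamma])].
Proof.
case=> -[x0 y0] [[/= hy nroot] hdeg hreg].
have r0 : (0 < r)%N by rewrite lt0n; apply: contraNneq hr => ->; rewrite dvdn0.
have [qs|qs] := boolP (q %| size s)%N; last by constructor 1.
have [snil [z [d sE]]] := hs.
have srs : {subset s <= rs} by move=> a; rewrite sE mem_filter => /andP[].
have count_s : count (mem s) rs = size s.
  rewrite [in RHS]sE size_filter; apply: eq_in_count => a ars.
  by rewrite /= sE mem_filter ars andbT.
have a0S : head 0 s \in s by case: (s) snil => // *; rewrite mem_head.
have [t [tS tN]] := (cluster_regionP hc hv x0 snil srs).1 hreg.
have ld0 : iota (lead_coef F) != 0.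
  rewrite fmorph_eq0 lead_coef_eq0 -size_poly_gt0.
  exact: ltn_trans hF.1.
have root_rs : root (map_poly iota F) =1 mem rs.
  by move=> x; rewrite hrs rootZ// root_prod_XsubC.
have y00 : y0 != 0.
  apply/eqP => y00; apply: nroot; split => //=.
  rewrite -[_ \in _]root_rs /root -hy y00 expr0n.
  by rewrite gtn_eqF ?prime_gt0.
have x0rs : x0 \notin rs.
  by rewrite -[_ \in _]root_rs /root -hy expf_neq0.
have [T vT] : exists T : R, t = T%:E.
  have [|T vT] := valuation_EFin hv (x := x0 - head 0 s).
    by rewrite subr_eq0; apply: contraNneq x0rs => ->; exact: srs.
  by exists T; rewrite -vT tS.
subst t.
(* [tail] is [c_s] with the chosen root of [s] replaced by [x]. It takes the same value at the roots
   of [s], at [x0] and at [gamma], all of which satisfy the bound in [tail_eq]. *)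
pose tail x := (v (iota (lead_coef F)) + \sum_(b <- rs | b \notin s) v (x - b)%R)%E.
have vF x : {in s, forall a, v (x - a) = T%:E} ->
    v (map_poly iota F).[x] = (tail x + ((size s)%:R * T)%:E)%E.
  move=> xs; rewrite hrs hornerZ horner_prod (valuationM hv) (valuation_prod hv).
  rewrite (bigID (mem s))/= [X in (_ + X)%E]addeC addeA; congr (_ + _ + _)%E.
    by apply: eq_bigr => a _; rewrite hornerXsubC.
  rewrite (eq_bigr (fun=> T%:E)); last first.
    by move=> a /xs <-; rewrite hornerXsubC.
  by rewrite sumEFin big_const_seq count_s iter_addr_0 mulr_natl.
have tail_eq x : (T%:E <= v (x0 - x)%R)%E -> tail x = tail x0.
  move=> xT; rewrite /tail big_seq_cond [in RHS]big_seq_cond; congr (_ + _)%E.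
  apply: eq_bigr => b /andP[brs bS].
  have -> : x - b = (x0 - b) - (x0 - x) by ring.
  by apply: (valuationB_eq hv); apply: lt_le_trans (tN b brs bS) xT.
have [a [a' [aS a'S aa']]] := gamma_close hc hv hext hred hrep hpi hgamma.
have gS : {in s, forall b, (T%:E <= v (iota gamma - b)%R)%E}.
  move=> b bS; apply: le_trans (aa' b bS).
  have -> : a - a' = (x0 - a') - (x0 - a) by ring.
  by apply: (valuationB_ge hv); rewrite tS.
have x0g : (T%:E <= v (x0 - iota gamma)%R)%E.
  have -> : x0 - iota gamma = (x0 - a) - (iota gamma - a) by ring.
  by apply: (valuationB_ge hv); rewrite ?tS// gS.
have gN : {in rs, forall b, b \notin s -> (v (iota gamma - b)%R < T%:E)%E}.
  move=> b brs bS; have -> : iota gamma - b = (x0 - b) - (x0 - iota gamma) by ring.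
  have xb := tN b brs bS.
  by rewrite (valuationB_eq hv)//; apply: lt_le_trans xb x0g.
have [h hh] := shifted_coef_valuation hv hrs (fun b _ => gS b) gN.
have [Y vY] := valuation_EFin hv y00.
have qY : (q%:R * Y)%:E = (tail x0 + ((size s)%:R * T)%:E)%E.
  by rewrite -vF// -hy (valuationX hv _ vY).
(* The value at [gamma] is the valuation of the coefficient [h] in K. If [h] were zero, [q v(y0)]
   would be infinite. *)
have [N hN] : exists N : int, tail x0 = (N%:~R)%:E.
  rewrite -(tail_eq (iota gamma))// /tail -hh.
  have [|N hN] := hZ.1 h; last by exists N; rewrite hext.
  rewrite -(fmorph_eq0 iota); apply: contra_eq_neq qY => h0.
  by move: hh; rewrite h0 (valuation0 hv) -/(tail _) tail_eq// => <-.
rewrite hN -EFinD in qY; case: qY => qY.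
have adjM (w x : Kbar) : adjoin iota [:: x0; y0] w -> adjoin iota [:: x0; y0] x ->
    adjoin iota [:: x0; y0] (w * x).
  move=> aw ax M hM hK hS; case: (hM) => M1 MB MD.
  (* [divring_closed] gives closure under division, so the product is obtained as [w] divided by the
     inverse of [x]. *)
  have xV : x^-1 \in M by rewrite -div1r; apply: MD => //; exact: ax.
  by rewrite -[x]invrK; apply: MD => //; exact: aw.
have [m1 hm1] : exists m : int, r%:R * Y = m%:~R.
  apply: (valuation_extension_degree hZ hH hv hext hdeg r0 _ vY) => x.
  by apply: adjM => M hM hK hS; apply: hS; rewrite !inE eqxx orbT.
have cop (n m : int) : r%:Z * n = q%:Z * m -> exists l, n = q%:Z * l.
  move=> e; have : (q%:Z %| r%:Z * n)%Z by rewrite e dvdz_mulr.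
  rewrite Gauss_dvdzr ?coprimezE ?prime_coprime// => /dvdzP[l ->].
  by exists l; rewrite mulrC.
have [vg|vg] := eqVneq (v (x0 - iota gamma)) T%:E.
  constructor 2; split => //.
  have [m2 hm2] : exists m : int, r%:R * T = m%:~R.
    apply: (valuation_extension_degree hZ hH hv hext hdeg r0 _ vg) => x.
    apply: adjM => M hM hK hS; case: (hM) => _ MB _; apply: MB => //.
    by apply: hS; rewrite mem_head.
  have [k' sk] := dvdnP qs.
  (* Multiplying [q Y = N + |s| T] by [r], with [|s| = k' q], gives [r N = q (m1 - k' m2)]. *)
  have [|l Nl] := cop N (m1 - k'%:Z * m2).
    apply/eqP; rewrite -(eqr_int R) !rmorphM rmorphB rmorphM /= -hm1 -hm2.
    apply/eqP; rewrite -!pmulrn; move: qY; rewrite sk natrM => qY.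
    have -> : N%:~R = q%:R * Y - k'%:R * q%:R * T by rewrite qY addrK.
    by ring.
  by exists l; rewrite -Nl -hN -(tail_eq (head 0 s)) ?tS.
constructor 4.
have gT : {in s, forall b, v (iota gamma - b) = T%:E}.
  move=> b bS; have -> : iota gamma - b = (x0 - b) - (x0 - iota gamma) by ring.
  by rewrite (valuationB_eq hv) tS// lt_neqAle eq_sym vg x0g.
split; first by apply/(cluster_regionP hc hv _ snil srs); exists T%:E.
have vFg : vK F.[gamma] = (q%:R * Y)%:E.
  by rewrite -hext -horner_map vF// tail_eq// hN -EFinD qY.
have [|N2 hN2] := hZ.1 F.[gamma].
  by rewrite -(fmorph_eq0 iota); apply: (valuation_neq0 hv); rewrite hext vFg.
(* Here [N2 = v(F(gamma)) = q v(y0)], and [r v(y0) = m1]. *)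
have [|l N2l] := cop N2 m1.
  apply/eqP; rewrite -(eqr_int R) !rmorphM /= -hm1 -!pmulrn.
  by move: hN2; rewrite vFg => -[<-]; apply/eqP; ring.
by exists l; rewrite hN2 N2l.
Qed.
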